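(* Let $L$ be an oriented link with $\mu(L)$ components, represented by a connected oriented planar diagram, and let $S$ be any FKT state of this diagram (for any choice of two adjacent starred regions). Then the number $\sharp B_S$ of black holes and the number $\sharp W_S$ of white holes in $S$ have equal parities when $\mu(L)$ is odd, and opposite parities when $\mu(L)$ is even. Equivalently, $\sharp B_S+\sharp W_S\equiv \mu(L)+1 \pmod 2$.
   Context: Let $P_L$ be a connected oriented planar diagram of $L$ with crossings $v_1,\dots,v_n$; it divides the plane into $n+2$ regions (one unbounded). Two regions are adjacent if they share an edge of the diagram. Choose two adjacent regions and mark each with a star. An FKT state $S$ is an assignment, to each crossing $v_i$, of a marker placed in one of the four local corners at $v_i$ belonging to an unstarred region, such that no region contains more than one marker. A marker at a crossing is a black hole if it lies in the corner between the two ingoing strands at that crossing, and a white hole if it lies in the corner between the two outgoing strands. $B_S$ (resp. $W_S$) is the set of markers of $S$ that are black (resp. white) holes, and $\sharp$ denotes cardinality. *)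

(* Defs.v *)
From HB Require Import structures.
From mathcomp Require Import all_boot all_fingroup.
Set Implicit Arguments.
Unset Strict Implicit.
Unset Printing Implicit Defensive.

(* Oriented link diagrams as combinatorial maps.

   Rotate each crossing so that both strands run upwards:

            (c, false)   (c, true)       outgoing ends
                     \   /
                       c
                     /   \
            (c, false)   (c, true)       incoming ends

   An end is a pair (c, b), with b = false on the left and b = true on the
   right. A strand coming in on one side leaves on the other, and the plane is
   oriented counterclockwise. [arc] sends the outgoing end where an arc of the
   diagram starts to the incoming end where it stops; [circle] indexes the
   components without crossings, so that the round unknot is a diagram; and
   [over c] is the side on which the overpassing strand of c comes in. *)
Record link_diagram := LinkDiagram {
  crossing : finType;
  circle : finType;
  arc : {perm (crossing * bool)%type};
  over : crossing -> bool
}.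

Variant corner := InCorner | OutCorner | LeftCorner | RightCorner.

Definition bool_of_corner k :=
  match k with
  | InCorner => (false, false)
  | OutCorner => (false, true)
  | LeftCorner => (true, false)
  | RightCorner => (true, true)
  end.

Definition corner_of_bool p :=
  match p with
  | (false, false) => InCorner
  | (false, true) => OutCorner
  | (true, false) => LeftCorner
  | (true, true) => RightCorner
  end.

Lemma bool_of_cornerK : cancel bool_of_corner corner_of_bool.
Proof. by case. Qed.

Lemma corner_of_boolK : cancel corner_of_bool bool_of_corner.
Proof. by case=> [[] []]. Qed.

HB.instance Definition _ := Finite.copy corner (can_type bool_of_cornerK).

Section Diagram.
Variable D : link_diagram.

(* An edge with crossings is named by the outgoing end where it starts. *)
Definition edge : finType := (crossing D * bool + circle D)%type.

Definition edge_from (c : crossing D) (b : bool) : edge := inl (c, b).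
Definition edge_into (c : crossing D) (b : bool) : edge :=
  inl ((arc D)^-1%g (c, b)).

Definition straight_fun (e : edge) : edge :=
  match e with
  | inl p => edge_from (arc D p).1 (~~ (arc D p).2)
  | inr o => inr o
  end.

Lemma straight_inj : injective straight_fun.
Proof.
move=> [p|o] [q|o'] //=.
case=> h1 /(can_inj negbK) h2; congr inl; apply: (@perm_inj _ (arc D)).
by rewrite [LHS]surjective_pairing h1 h2 -surjective_pairing.
Qed.

(* Following the link from edge to edge; its cycles are the components. *)
Definition straight : {perm edge} := perm straight_inj.

(* mu(L) *)
Definition num_components : nat := #|porbits straight|.

(* (e, false) is the left side of e, walked forwards, and (e, true) its right
   side, walked backwards: the bordering region is always on the walker's
   left. *)
Definition side : finType := (edge * bool)%type.

(* The corner turned when reaching the end of a side walked that way. *)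
Definition corner_ahead (p : crossing D * bool) (back : bool) :
    crossing D * corner :=
  if back then (p.1, if p.2 then RightCorner else OutCorner)
  else ((arc D p).1, if (arc D p).2 then InCorner else LeftCorner).

(* The side walked next after turning a corner. *)
Definition corner_side (c : crossing D) (k : corner) : side :=
  match k with
  | LeftCorner => (edge_from c false, false)
  | OutCorner => (edge_from c true, false)
  | InCorner => (edge_into c false, true)
  | RightCorner => (edge_into c true, true)
  end.

Definition boundary_fun (s : side) : side :=
  match s with
  | (inl p, back) =>
      let: (c, k) := corner_ahead p back in corner_side c k
  | (inr o, back) => (inr o, back)
  end.

Lemma boundary_inj : injective boundary_fun.
Proof.
have cs_inj c k c' k' : corner_side c k = corner_side c' k' ->
    (c, k) = (c', k').
  by case: k; case: k' => //= -[] //; (move/perm_inj=> [] // -> || move=> ->).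
have ca_inj p r p' r' : corner_ahead p r = corner_ahead p' r' ->
    (p, r) = (p', r').
  rewrite /corner_ahead; case: r; case: r' => /=.
  - by case: p p' => [c []] [c' []] /= [->].
  - by case: p.2; case: (arc D p').2.
  - by case: p'.2; case: (arc D p).2.
  - move=> [h1 h2]; congr pair; apply: (@perm_inj _ (arc D)).
    rewrite [LHS]surjective_pairing [RHS]surjective_pairing h1.
    by case: (arc D p).2 (arc D p').2 h2 => [] [].
have csl c k : exists p r, corner_side c k = (inl p, r).
  by case: k; do 2!eexists.
move=> [[p|o] r] [[p'|o'] r'] /=.
- case E: (corner_ahead p r) => [c k]; case E': (corner_ahead p' r') => [c' k'].
  move/cs_inj=> eqck; have [-> ->//] : (p, r) = (p', r').
  by apply: ca_inj; rewrite E E'.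
- by case: (corner_ahead p r) => c k; have [q [t ->]] := csl c k.
- by case: (corner_ahead p' r') => c k; have [q [t ->]] := csl c k.
- by [].
Qed.

Definition boundary : {perm side} := perm boundary_inj.

(* A region is identified with the set of sides of edges that border it; this
   is accurate for connected diagrams, whose regions have one boundary walk
   each. *)
Definition regions : {set {set side}} := porbits boundary.
Definition region_of_side (s : side) : {set side} := porbit boundary s.
Definition region_at (c : crossing D) (k : corner) : {set side} :=
  region_of_side (corner_side c k).

Definition incident (e : edge) (c : crossing D) : bool :=
  [exists b, (e == edge_from c b) || (e == edge_into c b)].

Definition touching : rel edge :=
  fun e e' => [exists c, incident e c && incident e' c].

Definition connected_diagram : bool :=
  [forall e, forall e', connect touching e e'].

(* Euler's formula V - E + F = 2, where E = 2V as soon as V > 0; the round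
   unknot has no crossing and two regions. The equation also excludes the empty
   diagram. *)
Definition planar_diagram : bool := #|regions| == #|crossing D| + 2.

Definition adjacent (r1 r2 : {set side}) : bool :=
  (r1 != r2) && [exists e : edge,
    (r1 == region_of_side (e, false)) && (r2 == region_of_side (e, true)) ||
    (r2 == region_of_side (e, false)) && (r1 == region_of_side (e, true))].

(* The marker of the crossing c is put in its corner S c. *)
Definition FKT_state (r1 r2 : {set side}) (S : crossing D -> corner) : Prop :=
  (forall c, region_at c (S c) != r1 /\ region_at c (S c) != r2) /\
  injective (fun c => region_at c (S c)).

Definition black_holes (S : crossing D -> corner) : {set crossing D} :=
  [set c | S c == InCorner].
Definition white_holes (S : crossing D -> corner) : {set crossing D} :=
  [set c | S c == OutCorner].

End Diagram.

(* Main.v *)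
Require Import Defs.
From mathcomp Require Import all_boot all_fingroup.

Set Implicit Arguments.
Unset Strict Implicit.
Unset Printing Implicit Defensive.

(** Smooth every crossing by joining the marked corner to the opposite one. The
    strands are then reconnected along the orientation of the link exactly where
    the marker is a black or white hole. The proof compares the number of closed
    curves of three diagrams modulo 2: the link itself, with mu curves; its
    Seifert smoothing, where every crossing is smoothed along the orientation;
    and the smoothing given by the state, which is one single curve, the trail
    of the state.

    Curves are counted as cycles of permutations of darts, where a dart is an
    edge end leaving its crossing. Walking along a smoothed diagram, one takes
    the opposite dart [a x] of the edge, then the dart to which the smoothing
    connects it; each curve is walked in both directions, so it gives two
    cycles. To count it once, the walk is restricted to a set of darts that is
    stable under the walk and complementary to its image by [a], that is, to a
    choice of directions. Two walks that respect the same directions have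
    comparable signs: at each crossing where they differ, their quotient is a
    product of two transpositions, one on either side of the choice. The link
    and its Seifert smoothing both respect the orientation of the link, whence
    #curves(Seifert) = mu + n modulo 2 for n crossings. The Seifert smoothing
    and the trail both respect a checkerboard colouring, a region being kept on
    the left or on the right according to its colour; whence
    1 = #curves(Seifert) + (number of markers that are not holes) modulo 2.
    Lemma [odd_restr_half] says that the parity for the Seifert smoothing is the
    same for both choices of directions, and [odd_straight_walk] adds things up.

    The colouring and the uniqueness of the trail come together, in
    [state_trail]. The boundary walks of the regions become walks around the
    smoothed diagram when one multiplies by one transposition for each crossing,
    exchanging a dart of the marked region with one of the region facing it. Add
    these transpositions one by one, each time with a facing region that has
    been reached already from a star: since the marked region is still intact,
    two cycles merge. When this process stops, the regions reached fill
    exactly two cycles of the walk around the smoothed diagram, those of the two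
    sides of the edge between the stars. Reversing the direction exchanges these
    two, so the set of the regions reached is closed under the reversal of
    darts; as the diagram is connected, these are all the regions. The two
    colours are the two cycles. *)

Local Open Scope group_scope.

(** * Orbits of permutations *)

Section Orbits.
Variable T : finType.
Implicit Types (s t : {perm T}) (A B : {set T}).

Lemma astabs_permP s A :
  reflect (forall x, (s x \in A) = (x \in A)) (s \in 'N(A | 'P)).
Proof. by apply: (iffP astabsP) => h x; apply: h. Qed.

Lemma closed_astabs s A : {in A, forall x, s x \in A} -> s \in 'N(A | 'P).
Proof.
move=> sA; apply/astabs_permP.
have /eqP imA : s @: A == A.
  rewrite eqEcard card_imset ?leqnn ?andbT; last exact: perm_inj.
  by apply/subsetP=> _ /imsetP[x /sA ? ->].
by move=> x; rewrite -{1}imA (mem_imset _ _ (@perm_inj _ s)).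
Qed.

Lemma porbit_sub s A x :
  s \in 'N(A | 'P) -> x \in A -> porbit s x \subset A.
Proof.
move=> nAs xA; apply/subsetP=> _ /porbitP[i ->].
by have /astabs_permP-> := groupX i nAs.
Qed.

Lemma porbit_step s x y : (s y \in porbit s x) = (y \in porbit s x).
Proof. by rewrite -!eq_porbit_mem -(porbit_perm s 1 y) expg1. Qed.

Lemma porbit_astabs s x : s \in 'N(porbit s x | 'P).
Proof. by apply/astabs_permP=> y; apply: porbit_step. Qed.

Lemma porbit_eq_in s t A x :
    s \in 'N(A | 'P) -> {in A, s =1 t} -> x \in A ->
  porbit s x = porbit t x.
Proof.
move=> nAs eq_st xA.
have iterE i : (s ^+ i) x = (t ^+ i) x.
  elim: i => [|i IHi]; first by rewrite !expg0.
  rewrite !expgSr !permM -IHi eq_st //.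
  by have /astabs_permP-> := groupX i nAs.
by apply/setP=> y; apply/porbitP/porbitP=> -[i ->]; exists i; rewrite iterE.
Qed.

Lemma porbit_coarser s t :
  (forall x, s x \in porbit t x) -> forall x, porbit s x \subset porbit t x.
Proof.
move=> sub1 x; apply: porbit_sub (porbit_id t x); apply: closed_astabs => y.
by rewrite -eq_porbit_mem => /eqP <-.
Qed.

(** Multiplying by a transposition of two points of different orbits glues these
    orbits: starting from [y], the new permutation follows the old one until it
    comes to the predecessor of [y], which it sends to [x]. *)
Lemma porbit_mul_tperm_merge s x y :
    x \notin porbit s y ->
  (forall z, s z \in porbit (s * tperm x y) z)
    /\ x \in porbit (s * tperm x y) y.
Proof.
move=> xNy; set t := s * tperm x y.
have follow : porbit s y \subset porbit t y.
  apply/subsetP=> _ /porbitP[i ->]; elim: i => [|i IHi].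
    by rewrite expg0 perm1 porbit_id.
  rewrite expgSr permM; set z := (s ^+ i) y in IHi *.
  have sz : s z \in porbit s y by rewrite porbit_step mem_porbit.
  have [->|nzy] := eqVneq (s z) y; first exact: porbit_id.
  have nzx : s z != x by apply: contraNneq xNy => <-.
  by rewrite -(tpermD (x:=x) (y:=y) (z:=s z)) 1?eq_sym // -permM porbit_step.
have xy : x \in porbit t y.
  have: s^-1 y \in porbit s y by rewrite -porbit_step permKV porbit_id.
  by move/(subsetP follow); rewrite -porbit_step permM permKV tpermR.
split=> // z; have : t z \in porbit t z by rewrite porbit_step porbit_id.
rewrite {1}/t permM; case: tpermP => [->|->|//]; rewrite -!eq_porbit_mem.
  by move/eqP <-; rewrite eq_porbit_mem.
by move/eqP <-; rewrite eq_sym eq_porbit_mem.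
Qed.

End Orbits.

(** * Reversible walks *)

Section Reversal.
Variables (T : finType) (a v : {perm T}).
Hypotheses (aK : involutive a) (vK : involutive v).
Hypotheses (a_free : forall x, a x != x) (v_free : forall x, v x != x).
Local Notation g := (a * v).

Lemma invol_perm_inv : a^-1 = a.
Proof. by apply/permP=> x; apply: (@perm_inj _ a); rewrite permKV aK. Qed.

Lemma walk_conj_reverse : g ^ a = g^-1.
Proof.
rewrite conjgE invol_perm_inv; apply: (mulgI g); rewrite mulgV.
by apply/permP=> x; rewrite !permM perm1 aK vK aK.
Qed.

Lemma walk_reverse i x : a ((g ^+ i) x) = (g ^- i) (a x).
Proof. by rewrite -expgVn -walk_conj_reverse -conjXg permJ. Qed.

Lemma porbit_reverse x y : (a y \in porbit g (a x)) = (y \in porbit g x).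
Proof.
have half z w : w \in porbit g z -> a w \in porbit g (a z).
  by case/porbitP=> i ->; rewrite walk_reverse -expgVn -porbitV mem_porbit.
by apply/idP/idP => /half //; rewrite !aK.
Qed.

(** A walk never comes back on its own track in the opposite direction: it would
    have to turn back halfway, in the middle of an edge or at a crossing. *)
Lemma reverse_notin_porbit x : a x \notin porbit g x.
Proof.
apply/negP=> /porbitP[k]; rewrite -{1}(odd_double_half k).
set j := k./2; set y := (g ^+ j) x.
have ay : a y = (g ^- j) (a x) by rewrite /y walk_reverse.
case: (odd k) => axE; last first.
  case/eqP: (a_free y); rewrite ay axE add0n -addnn expgD permM.
  by rewrite -/y permK.
case/eqP: (v_free (a y)); rewrite -[LHS]permM ay axE -addnn addnA expgD.
by rewrite [X in _ = _ X]permM permK expgSr [RHS]permM.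
Qed.
End Reversal.

(** * Signs of restricted permutations *)

Section RestrictedSigns.
Variable T : finType.
Implicit Types (s t a : {perm T}) (A B : {set T}).

Lemma restr_permP s t A :
    s \in 'N(A | 'P) -> {in A, s =1 t} -> {in ~: A, forall x, t x = x} ->
  restr_perm A s = t.
Proof.
move=> nAs eq_st t_id; apply/permP=> x; have [xA|xNA] := boolP (x \in A).
  by rewrite restr_permE ?eq_st.
by rewrite (out_perm (restr_perm_on A s)) // t_id // inE.
Qed.

Lemma odd_restr_permM s t A : s \in 'N(A | 'P) -> t \in 'N(A | 'P) ->
  odd_perm (restr_perm A (s * t)) =
    odd_perm (restr_perm A s) (+) odd_perm (restr_perm A t).
Proof. by move=> nAs nAt; rewrite morphM // odd_permM. Qed.

Lemma restr_perm_setU s A B :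
    s \in 'N(A | 'P) -> s \in 'N(B | 'P) -> [disjoint A & B] ->
  restr_perm (A :|: B) s = restr_perm A s * restr_perm B s.
Proof.
move=> nAs nBs disAB; have nABs : s \in 'N(A :|: B | 'P).
  apply/astabs_permP=> x.
  by rewrite !inE (astabs_permP _ _ nAs) (astabs_permP _ _ nBs).
apply: restr_permP => // x; rewrite !inE permM.
  case/orP=> [xA|xB].
    rewrite (restr_permE nAs xA) (out_perm (restr_perm_on B s)) //.
    by rewrite (disjointFr disAB) // (astabs_permP _ _ nAs).
  rewrite (out_perm (restr_perm_on A s)) ?restr_permE //.
  by rewrite (disjointFl disAB).
case/norP=> xNA xNB; rewrite (out_perm (restr_perm_on A s)) //.
exact: out_perm (restr_perm_on B s) xNB.
Qed.

Lemma restr_permJ s a A B :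
    s \in 'N(A | 'P) -> (forall x, (a x \in B) = (x \in A)) ->
  restr_perm B (s ^ a) = restr_perm A s ^ a.
Proof.
move=> nAs aAB; apply: restr_permP => [|y|y].
- apply/astabs_permP=> y.
  by rewrite -(permKV a y) permJ !aAB (astabs_permP _ _ nAs).
- rewrite -{1}(permKV a y) aAB => xA.
  by rewrite -(permKV a y) !permJ restr_permE.
rewrite -(permKV a y) inE aAB => xNA.
by rewrite permJ (out_perm (restr_perm_on A s)).
Qed.

(** The orbits of the restriction are those of [s] contained in [A], and one
    fixed point for each element of the complement of [A]. *)
Lemma odd_restr_perm s A : s \in 'N(A | 'P) ->
  odd_perm (restr_perm A s) =
    odd #|A| (+) odd #|[set P in porbits s | P \subset A]|.
Proof.
move=> nAs; set r := restr_perm A s; set Q := [set P in _ | _].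
have porbit_in x : x \in A -> porbit r x = porbit s x.
  move=> xA; symmetry; apply: porbit_eq_in (nAs) _ xA => y yA.
  by rewrite /r restr_permE.
have porbit_out x : x \notin A -> porbit r x = [set x].
  move=> xNA; apply/eqP; rewrite eqEsubset sub1set porbit_id andbT.
  apply: porbit_sub (set11 x); apply: closed_astabs => y /set1P->.
  by rewrite (out_perm (restr_perm_on A s)) ?inE.
have -> : odd_perm r = odd #|T| (+) odd #|porbits r| by [].
have -> : porbits r = Q :|: [set [set x] | x in ~: A].
  apply/setP=> P; rewrite !inE; apply/imsetP/idP.
    case=> x _ ->; have [xA|xNA] := boolP (x \in A).
      by rewrite porbit_in // imset_f // porbit_sub.
    by rewrite porbit_out // orbC imset_f ?inE.
  case/orP=> [/andP[/imsetP[x _ ->] /subsetP sxA]|/imsetP[x]].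
    by exists x; rewrite ?porbit_in ?sxA ?porbit_id.
  by rewrite inE => xNA ->; exists x; rewrite ?porbit_out.
rewrite cardsU; have -> : Q :&: [set [set x] | x in ~: A] = set0.
  apply/setP=> P; rewrite [RHS]inE [LHS]inE inE.
  apply/negP=> /andP[/andP[_ sPA]].
  case/imsetP=> x; rewrite inE => /negP xNA PE; apply: xNA.
  by rewrite -sub1set -PE.
rewrite cards0 subn0 card_imset; last exact: set1_inj.
rewrite -(cardsC A) !oddD.
by case: (odd _); case: (odd _); case: (odd _).
Qed.

Lemma odd_restr_porbit s x :
  odd_perm (restr_perm (porbit s x) s) = ~~ odd #|porbit s x|.
Proof.
rewrite odd_restr_perm ?porbit_astabs //.
suff -> : [set P in porbits s | P \subset porbit s x] = [set porbit s x].
  by rewrite cards1 addbT.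
apply/setP=> P; rewrite !inE; apply/andP/eqP => [[]|->].
  case/imsetP=> y _ -> /subsetP/(_ y (porbit_id s y)).
  by rewrite -eq_porbit_mem => /eqP.
by rewrite subxx imset_f.
Qed.

Lemma odd_restr_tperm A x y : x != y -> x \in A -> y \in A ->
  odd_perm (restr_perm A (tperm x y)) = true.
Proof.
move=> nxy xA yA; rewrite (@restr_permP _ (tperm x y)) ?odd_tperm //.
  by apply: closed_astabs => z zA; case: tpermP.
by move=> z; rewrite inE => zNA; rewrite tpermD //; apply: contraNneq zNA => <-.
Qed.

Lemma odd_restr_tperm_out A x y : x \notin A -> y \notin A ->
  odd_perm (restr_perm A (tperm x y)) = false.
Proof.
move=> xNA yNA; rewrite (@restr_permP _ 1) ?odd_perm1 //.
- apply/astabs_permP=> z.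
  by case: tpermP => // ->; rewrite (negPf xNA) (negPf yNA).
- move=> z zA; rewrite perm1 tpermD //; first by apply: contraNneq xNA => ->.
  by apply: contraNneq yNA => ->.
by move=> z _; rewrite perm1.
Qed.

(** The sets [A] and [B] are two choices of directions for the cycles of [s],
    which [a] reverses. Beyond their common part [A :&: B], the two restrictions
    consist of the same cycles, run in opposite directions, so their signs
    agree. *)
Lemma odd_restr_half s a A B :
    involutive a -> s ^ a = s^-1 ->
    s \in 'N(A | 'P) -> s \in 'N(B | 'P) ->
    (forall x, (a x \in A) = (x \notin A)) ->
    (forall x, (a x \in B) = (x \notin B)) ->
  odd_perm (restr_perm A s) = odd_perm (restr_perm B s).
Proof.
move=> aK saV nAs nBs aA aB.
have nCs C : s \in 'N(C | 'P) -> s \in 'N(~: C | 'P).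
  by move/astabs_permP=> nCs; apply/astabs_permP=> x; rewrite !inE nCs.
have nIs C D : s \in 'N(C | 'P) -> s \in 'N(D | 'P) -> s \in 'N(C :&: D | 'P).
  move=> /astabs_permP nC /astabs_permP nD; apply/astabs_permP=> x.
  by rewrite !inE nC nD.
have split C D : s \in 'N(C | 'P) -> s \in 'N(D | 'P) ->
    odd_perm (restr_perm C s) = odd_perm (restr_perm (C :&: D) s)
      (+) odd_perm (restr_perm (C :&: ~: D) s).
  move=> nC nD; rewrite -odd_permM -restr_perm_setU ?nIs ?nCs //.
    by rewrite -setIUr setUCr setIT.
  by apply/pred0P=> x; rewrite /= !inE; case: (x \in C) (x \in D) => [] [].
rewrite (split A B) // (split B A) // setIC; congr addb.
rewrite -[RHS]odd_permV.
have -> : (restr_perm (B :&: ~: A) s)^-1 = restr_perm (B :&: ~: A) (s ^ a).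
  by rewrite saV morphV ?nIs ?nCs.
rewrite (@restr_permJ _ _ (A :&: ~: B)) ?odd_permJ ?nIs ?nCs // => x.
by rewrite !inE aA aB negbK andbC.
Qed.

End RestrictedSigns.

Lemma porbit_codom (Y T : finType) (f : Y -> T) (s : {perm Y})
    (t : {perm T}) :
  (forall y, t (f y) = f (s y)) -> forall y, porbit t (f y) = f @: porbit s y.
Proof.
move=> tf y; have tfX i : (t ^+ i) (f y) = f ((s ^+ i) y).
  elim: i => [|i IHi]; first by rewrite !expg0 !perm1.
  by rewrite !expgSr !permM IHi tf.
apply/setP=> x; apply/porbitP/imsetP => [[i ->]|[_ /porbitP[i ->] ->]].
  by exists ((s ^+ i) y); rewrite ?mem_porbit.
by exists i.
Qed.

Lemma odd_restr_codom (Y T : finType) (f : Y -> T) (s : {perm Y})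
    (t : {perm T}) :
    injective f -> (forall y, t (f y) = f (s y)) ->
  odd_perm (restr_perm (f @: Y) t)
    = odd #|f @: Y| (+) odd #|porbits s|.
Proof.
move=> f_inj tf; rewrite odd_restr_perm; last first.
  by apply: closed_astabs => _ /imsetP[y _ ->]; rewrite tf imset_f.
have porbitf := porbit_codom tf.
congr (addb _ (odd _)).
rewrite -(card_imset _ (imset_inj f_inj)); congr #|pred_of_set _|.
apply/setP=> P; rewrite inE; apply/andP/imsetP => [[/imsetP[x _ ->] sxY]|].
  have /imsetP[y _ ->] := subsetP sxY x (porbit_id t x).
  by exists (porbit s y); rewrite ?imset_f ?porbitf.
case=> _ /imsetP[y _ ->] ->; rewrite -porbitf imset_f //; split=> //.
by rewrite porbitf; apply/imsetS/subsetP.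
Qed.

(** * Smoothings of a four-valent map *)

Definition next_corner k :=
  match k with
  | InCorner => LeftCorner
  | LeftCorner => OutCorner
  | OutCorner => RightCorner
  | RightCorner => InCorner
  end.

Lemma next_corner_inj : injective next_corner.
Proof. by move=> [] []. Qed.

(** Paired with a crossing, the corner [k] stands for the dart that leaves the
    crossing with this corner behind it on its left; [turn] then runs clockwise
    through the four darts of the crossing. *)
Definition turn : {perm corner} := perm next_corner_inj.

Definition opposite k := turn (turn k).

(** The arcs that replace a crossing when its corner [k] is joined to the
    opposite one, as an involution of the four darts of the crossing. *)
Definition smoothing k : {perm corner} := turn * tperm k (opposite k).

Lemma oppositeE k :
  opposite k = match k with
    | InCorner => OutCorner | OutCorner => InCorner
    | LeftCorner => RightCorner | RightCorner => LeftCorner end.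
Proof. by rewrite /opposite !permE; case: k. Qed.

Lemma smoothingE k l :
  smoothing k l =
    match k with
    | InCorner | OutCorner =>
      match l with InCorner => LeftCorner | LeftCorner => InCorner
                 | OutCorner => RightCorner | RightCorner => OutCorner end
    | LeftCorner | RightCorner =>
      match l with InCorner => RightCorner | RightCorner => InCorner
                 | OutCorner => LeftCorner | LeftCorner => OutCorner end
    end.
Proof. by rewrite permM oppositeE !permE; case: k; case: l. Qed.

Section Crossingwise.
Variable C : finType.
Implicit Types H : C -> {perm corner}.

Definition crossingwise_fun H (x : C * corner) := (x.1, H x.1 x.2).

Lemma crossingwise_inj H : injective (crossingwise_fun H).
Proof. by move=> [c k] [c' k'] [-> /perm_inj->]. Qed.

Definition crossingwise H : {perm C * corner} := perm (@crossingwise_inj H).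

Lemma crossingwiseE H c k : crossingwise H (c, k) = (c, H c k).
Proof. by rewrite permE. Qed.

Lemma eq_crossingwise H H' : H =1 H' -> crossingwise H = crossingwise H'.
Proof. by move=> eqH; apply/permP=> -[c k]; rewrite !crossingwiseE eqH. Qed.

Lemma crossingwiseM H H' :
  crossingwise H * crossingwise H' = crossingwise (fun c => H c * H' c).
Proof. by apply/permP=> -[c k]; rewrite permM !crossingwiseE permM. Qed.

Lemma crossingwise_tperm c k l :
  crossingwise (fun c' => if c' == c then tperm k l else 1)
    = tperm (c, k) (c, l).
Proof.
apply/permP=> -[c' k']; rewrite crossingwiseE.
have [->|nc'c] := eqVneq c' c; last first.
  by rewrite perm1 tpermD // xpair_eqE eq_sym (negPf nc'c).
case: (tpermP k l k') => [->|->|/eqP nk /eqP nl]; rewrite ?tpermL ?tpermR //.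
by rewrite tpermD // xpair_eqE eqxx eq_sym.
Qed.

End Crossingwise.

(** * The trail of a state *)

Section Trail.
Variables (C : finType) (a : {perm C * corner}).
Hypotheses (aK : involutive a) (a_free : forall x, a x != x).

(** From the far end of its edge, one goes on along the next dart clockwise, so
    that the region on the left stays the same. *)
Definition region_walk := a * crossingwise (fun=> turn).

Definition smoothed_walk (S : C -> corner) :=
  a * crossingwise (fun c => smoothing (S c)).

Lemma smoothing_invol (S : C -> corner) :
  involutive (crossingwise (fun c => smoothing (S c))).
Proof.
by move=> [c k]; rewrite !crossingwiseE !smoothingE; case: (S c); case: k.
Qed.

Lemma smoothing_free (S : C -> corner) x :
  crossingwise (fun c => smoothing (S c)) x != x.
Proof.
case: x => c k; rewrite crossingwiseE xpair_eqE eqxx smoothingE.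
by case: (S c); case: k.
Qed.

Lemma smoothed_walk_conj_reverse (S : C -> corner) :
  smoothed_walk S ^ a = (smoothed_walk S)^-1.
Proof. exact: walk_conj_reverse aK (smoothing_invol S). Qed.

Variables (S : C -> corner) (d : C * corner).

Definition marked c := (c, S c).
Definition facing c := (c, opposite (S c)).

Hypothesis unstarred : forall c,
  (marked c \notin porbit region_walk d)
    && (marked c \notin porbit region_walk (a d)).
Hypothesis marked_inj : forall c c',
  marked c' \in porbit region_walk (marked c) -> c = c'.
Hypothesis connected : forall B : {set C * corner},
  d \in B -> a \in 'N(B | 'P) -> region_walk \in 'N(B | 'P) -> B = setT.

Local Notation phi := region_walk.

(** The boundary walks after merging, for the crossings in [G] only, the marked
    region with the facing one. *)
Definition merged_walk (G : {set C}) :=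
  a * crossingwise (fun c => if c \in G then smoothing (S c) else turn).

Definition merged_regions (G : {set C}) :=
  porbit phi d :|: porbit phi (a d) :|: \bigcup_(c in G) porbit phi (marked c).

(** The invariant of the merging process. The first two clauses say that merging
    has cut no boundary walk, and that it has put all the regions reached into
    the orbits of the two sides of the edge between the stars; the last one keeps
    the other regions intact. *)
Definition grown (G : {set C}) :=
  [&& [forall x, phi x \in porbit (merged_walk G) x],
      merged_regions G \subset
        porbit (merged_walk G) d :|: porbit (merged_walk G) (a d)
    & [forall c in G, facing c \in merged_regions G]].

Lemma merged_walkE G x :
  merged_walk G x =
    let y := phi x in
    if y.1 \in G then tperm (marked y.1) (facing y.1) y else y.
Proof.
rewrite /merged_walk /phi !permM; case: (a x) => c k; rewrite !crossingwiseE /=.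
case: (c \in G) => //; rewrite permM /marked /facing.
case: (tpermP (S c) _ (turn k)) => [->|->|/eqP n1 /eqP n2];
  rewrite ?tpermL ?tpermR //.
by rewrite tpermD // xpair_eqE eqxx eq_sym.
Qed.

Lemma merged_walkU1 c (G : {set C}) : c \notin G ->
  merged_walk (c |: G) = merged_walk G * tperm (marked c) (facing c).
Proof.
move=> cNG; rewrite -crossingwise_tperm -mulgA crossingwiseM.
congr (a * _); apply: eq_crossingwise => c'; rewrite !inE.
by have [->|_] /= := eqVneq c' c; rewrite ?(negPf cNG) ?mulg1.
Qed.

Lemma merged_regions_phi G : phi \in 'N(merged_regions G | 'P).
Proof.
apply: closed_astabs => x; rewrite !inE !porbit_step.
case/orP=> [->//|/bigcupP[c cG xc]]; apply/orP; right.
by apply/bigcupP; exists c; rewrite ?porbit_step.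
Qed.

Lemma marked_merged G c : (marked c \in merged_regions G) = (c \in G).
Proof.
have /andP[/negPf n1 /negPf n2] := unstarred c.
rewrite !inE n1 n2 /=; apply/bigcupP/idP => [[c' c'G /marked_inj <-//]|cG].
by exists c; rewrite ?porbit_id.
Qed.

Lemma merged_regions_stable G (G' : {set C}) :
    (forall c, c \in G' ->
      (facing c \in merged_regions G) = (marked c \in merged_regions G)) ->
  merged_walk G' \in 'N(merged_regions G | 'P).
Proof.
move=> same; apply/astabs_permP=> x; rewrite merged_walkE /=.
rewrite -(astabs_permP _ _ (merged_regions_phi G) x).
case: ifP => // /same sf; case: tpermP => [->|->|//]; by rewrite sf.
Qed.

Lemma grown0 : grown set0.
Proof.
have phiE : merged_walk set0 = phi.
  by congr (a * _); apply: eq_crossingwise => c; rewrite inE.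
apply/and3P; rewrite phiE; split.
- by apply/forallP=> x; rewrite porbit_step porbit_id.
- by rewrite /merged_regions big_set0 setU0.
by apply/forallP=> c; rewrite inE.
Qed.

(** The merged walk is stable on the regions reached, which contain the region
    facing the new crossing but not its marked region, because each region has
    one marker at most. So the new transposition glues different orbits. *)
Lemma grownU1 c (G : {set C}) : c \notin G ->
  grown G -> facing c \in merged_regions G -> grown (c |: G).
Proof.
move=> cNG /and3P[/forallP phiG /subsetP regG /forall_inP facG] fcG.
have nG : merged_walk G \in 'N(merged_regions G | 'P).
  by apply: merged_regions_stable => c' c'G; rewrite marked_merged c'G facG.
have sep : marked c \notin porbit (merged_walk G) (facing c).
  apply: contra cNG => /(subsetP (porbit_sub nG fcG)).
  by rewrite marked_merged.
have [stepG glueG] := porbit_mul_tperm_merge sep.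
rewrite -merged_walkU1 // in stepG glueG.
set t := merged_walk (c |: G) in stepG glueG *.
have coarser := porbit_coarser stepG.
have phit x : phi x \in porbit t x by apply: subsetP (coarser x) _ (phiG x).
have subG : {subset merged_regions G <= porbit t d :|: porbit t (a d)}.
  move=> x /regG; rewrite !inE => /orP[] /(subsetP (coarser _)) ->//.
  by rewrite orbT.
have regE : merged_regions (c |: G)
    = merged_regions G :|: porbit phi (marked c).
  rewrite /merged_regions big_setU1 //= -!setUA.
  by do 2!congr (_ :|: _); rewrite setUC.
apply/and3P; split.
- exact/forallP.
- rewrite regE subUset; apply/andP; split; first exact/subsetP.
  apply: subset_trans (porbit_coarser phit _) _.
  move: glueG; rewrite -eq_porbit_mem => /eqP->.
  have := subG _ fcG; rewrite !inE -!eq_porbit_mem => /orP[] /eqP->.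
    exact: subsetUl.
  exact: subsetUr.
apply/forall_inP=> c'; rewrite regE !in_setU1 in_setU.
by case/predU1P=> [->|/facG->//]; rewrite fcG.
Qed.

(** The walk starting at [d] runs along the whole smoothed diagram in one
    direction, and its mirror image in the other. Every region lies entirely on
    one side of this closed curve, since its boundary walk has been merged into
    one of the two cycles. *)
Lemma state_trail :
  [/\ forall x, (a x \in porbit (smoothed_walk S) d)
        = (x \notin porbit (smoothed_walk S) d)
    & phi \in 'N(porbit (smoothed_walk S) d | 'P)].
Proof.
set g := smoothed_walk S.
have rev := porbit_reverse aK (smoothing_invol S).
have [G /maxsetP[grownG maxG] _] := maxset_exists grown0.
have facN c : c \notin G -> facing c \notin merged_regions G.
  move=> cNG; apply: contra (cNG) => fcG.
  have := maxG _ (grownU1 cNG grownG fcG) (subsetU1 c G).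
  by move/setP/(_ c); rewrite setU11.
case/and3P: grownG => /forallP phiG /subsetP regG /forall_inP facG.
have gT : g = merged_walk setT.
  by congr (a * _); apply: eq_crossingwise => c; rewrite inE.
have same c : (facing c \in merged_regions G) = (marked c \in merged_regions G).
  rewrite marked_merged; have [cG|cNG] := boolP (c \in G); first exact: facG.
  exact/negbTE/facN.
have nG : merged_walk G \in 'N(merged_regions G | 'P).
  by apply: merged_regions_stable.
have ng : g \in 'N(merged_regions G | 'P).
  by rewrite gT; apply: merged_regions_stable.
(* The remaining transpositions only move darts of regions not reached. *)
have eq_g : {in merged_regions G, merged_walk G =1 g}.
  move=> x; rewrite -(astabs_permP _ _ (merged_regions_phi G)).
  rewrite gT !merged_walkE /= in_setT; case: ifP => // /negbT cNG phix.
  rewrite tpermD //; apply: contraTneq phix => <-; rewrite ?same;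
  by rewrite marked_merged.
have dG : d \in merged_regions G by rewrite !inE porbit_id.
have adG : a d \in merged_regions G by rewrite !inE porbit_id orbT.
(* Reversal exchanges the orbits of [d] and [a d], which the regions reached
   fill; so these regions are closed under reversal. *)
have GT : merged_regions G = setT.
  apply: connected => //; last exact: merged_regions_phi.
  apply: closed_astabs => x /regG; rewrite inE.
  rewrite (porbit_eq_in nG eq_g dG) (porbit_eq_in nG eq_g adG).
  rewrite -(rev d x) -(rev (a d) x) aK => /orP[] xd.
    exact: subsetP (porbit_sub ng adG) _ xd.
  exact: subsetP (porbit_sub ng dG) _ xd.
have {}eq_g : merged_walk G = g.
  by apply/permP=> x; apply: eq_g; rewrite GT inE.
rewrite eq_g in regG phiG; split; last first.
  apply: closed_astabs => x; rewrite -!eq_porbit_mem => /eqP <-.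
  by rewrite eq_porbit_mem.
move=> x; have adN : a d \notin porbit g d.
  exact: reverse_notin_porbit aK (smoothing_invol S) a_free (smoothing_free S) d.
have xad : (a x \in porbit g d) = (x \in porbit g (a d)).
  by rewrite -(rev (a d) x) aK.
have : x \in merged_regions G by rewrite GT inE.
rewrite xad => /regG; rewrite inE.
have [xd _|_ /= -> //] := boolP (x \in porbit g d).
apply/negbTE; apply: contra adN; rewrite -!eq_porbit_mem in xd *.
by rewrite (eqP xd) eq_sym.
Qed.

End Trail.

(** * Parity of the number of oriented smoothings *)

Section Twists.
Variable C : finType.
Implicit Types (A : {set C * corner}) (D : {set C}).

Definition twist_at c (w : {perm corner}) : {perm C * corner} :=
  crossingwise (fun c' => if c' == c then w else 1).

(** Only one of the two transpositions moves elements of [A]. *)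
Lemma twist_at_double c A k l k' l' :
    k != l -> k' != l' ->
    ((c, l) \in A) = ((c, k) \in A) ->
    ((c, k') \in A) = ((c, k) \notin A) -> ((c, l') \in A) = ((c, k) \notin A) ->
  twist_at c (tperm k l * tperm k' l') \in 'N(A | 'P)
    /\ odd_perm (restr_perm A (twist_at c (tperm k l * tperm k' l'))) = true.
Proof.
move=> nkl nkl' lA k'A l'A.
have -> : twist_at c (tperm k l * tperm k' l')
    = tperm (c, k) (c, l) * tperm (c, k') (c, l').
  rewrite -!crossingwise_tperm crossingwiseM; apply: eq_crossingwise => c'.
  by case: eqP; rewrite ?mulg1.
have stable x y : (x \in A) = (y \in A) -> tperm x y \in 'N(A | 'P).
  by move=> xyA; apply/astabs_permP=> z; case: tpermP => // ->.
have n1 := stable (c, k) (c, l) (esym lA).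
have n2 : tperm (c, k') (c, l') \in 'N(A | 'P) by apply: stable; rewrite k'A.
have neq (x y : corner) : x != y -> (c, x) != (c, y).
  by rewrite xpair_eqE eqxx.
split; first exact: groupM.
rewrite odd_restr_permM //; case: (boolP ((c, k) \in A)) => ckA.
  rewrite odd_restr_tperm ?neq ?lA // odd_restr_tperm_out // ?k'A ?l'A ckA //.
rewrite odd_restr_tperm_out ?lA // odd_restr_tperm ?neq // ?k'A ?l'A //.
Qed.

Lemma odd_restr_twists A D (w : C -> {perm corner}) :
    (forall c, c \in D -> twist_at c (w c) \in 'N(A | 'P)
       /\ odd_perm (restr_perm A (twist_at c (w c))) = true) ->
  let t := crossingwise (fun c => if c \in D then w c else 1) in
  t \in 'N(A | 'P) /\ odd_perm (restr_perm A t) = odd #|D|.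
Proof.
elim: {D}_.+1 {-2}D (ltnSn #|D|) => // n IHn D leDn wD /=.
have [->|[c cD]] := set_0Vmem D.
  have -> : crossingwise (fun c => if c \in set0 then w c else 1) = 1.
    by apply/permP=> -[c k]; rewrite crossingwiseE inE !perm1.
  by rewrite group1 morph1 cards0 odd_perm1.
rewrite (cardsD1 c) cD in leDn *.
have [c' /setD1P[_ c'D]|nt odd_t] := IHn (D :\ c) leDn; first exact: wD.
have [nc odd_c] := wD c cD.
have -> : crossingwise (fun c => if c \in D then w c else 1)
    = twist_at c (w c)
      * crossingwise (fun c' => if c' \in D :\ c then w c' else 1).
  rewrite crossingwiseM; apply: eq_crossingwise => c'; rewrite !inE.
  by have [->|_] := eqVneq c' c; rewrite ?cD /= ?mulg1 ?mul1g.
by rewrite groupM // odd_restr_permM // odd_c odd_t.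
Qed.

End Twists.

Lemma card_half (T : finType) (a : {perm T}) (A : {set T}) :
  (forall x, (a x \in A) = (x \notin A)) -> #|A|.*2 = #|T|.
Proof.
move=> aA; rewrite -(cardsC A) -addnn; congr (_ + _)%N.
rewrite -(card_imset A (@perm_inj _ a)).
have -> : a @: A = ~: A; last by [].
apply/setP=> y; rewrite -(permKV a y) (mem_imset _ _ (@perm_inj _ a)) inE aA.
by rewrite negbK.
Qed.

Section StateParity.
Variables (C : finType) (a : {perm C * corner}).
Hypotheses (aK : involutive a).

Definition outgoing : {set C * corner} :=
  [set x | (x.2 == LeftCorner) || (x.2 == OutCorner)].

(** Two clockwise turns lead to the opposite dart: the link goes straight
    through its crossings. *)
Definition straight_walk := a * crossingwise (fun=> turn * turn).

Definition sideways (S : C -> corner) : {set C} :=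
  [set c | (S c == LeftCorner) || (S c == RightCorner)].

Hypothesis a_outgoing : forall x, (a x \in outgoing) = (x \notin outgoing).

Local Notation seifert_walk := (smoothed_walk a (fun=> InCorner)).

Lemma smoothed_walk_sideways S : smoothed_walk a S = seifert_walk *
  crossingwise (fun c => if c \in sideways S
    then tperm InCorner OutCorner * tperm LeftCorner RightCorner else 1).
Proof.
rewrite -mulgA crossingwiseM; congr (a * _); apply: eq_crossingwise => c.
rewrite inE; apply/permP=> k.
by rewrite permM !smoothingE; case: (S c); case: k; rewrite !permE //= !permE.
Qed.

Lemma straight_walk_seifert : straight_walk = seifert_walk *
  crossingwise (fun c => if c \in [set: C]
    then tperm LeftCorner OutCorner * tperm InCorner RightCorner else 1).
Proof.
rewrite -mulgA crossingwiseM; congr (a * _); apply: eq_crossingwise => c.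
rewrite inE; apply/permP=> k.
by rewrite [RHS]permM smoothingE; case: k; rewrite !permE //= !permE.
Qed.

(** Passing from the link to its Seifert smoothing changes the sign at each
    crossing, with directions chosen by the orientation of the link; passing from
    there to the trail [A] changes it at each marker that is not a hole, with
    directions chosen by [A]. There the trail is one cycle. *)
Lemma odd_straight_walk S x :
    let A := porbit (smoothed_walk a S) x in
    (forall y, (a y \in A) = (y \notin A)) ->
    region_walk a \in 'N(A | 'P) ->
  odd_perm (restr_perm outgoing straight_walk)
    = ~~ odd #|outgoing| (+) odd #|sideways S| (+) odd #|C|.
Proof.
move=> A aA nA.
(* Around a crossing the colours alternate, so [A] and its complement each
   contain one pair of opposite darts, and the Seifert smoothing connects darts
   of different colours. *)
have turnA c k : ((c, turn k) \in A) = ((c, k) \notin A).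
  by rewrite -aA -(astabs_permP _ _ nA) permM aK crossingwiseE.
have cornersA c : [/\ ((c, LeftCorner) \in A) = ((c, InCorner) \notin A),
    ((c, OutCorner) \in A) = ((c, InCorner) \in A)
    & ((c, RightCorner) \in A) = ((c, InCorner) \notin A)].
  have := (turnA c InCorner, turnA c LeftCorner, turnA c OutCorner).
  by rewrite !permE /= => -[[-> ->] ->]; rewrite !negbK.
have seifertA : seifert_walk \in 'N(A | 'P).
  apply/astabs_permP=> y; rewrite permM -[in RHS](aK y) aA.
  case: (a y) => c k; rewrite crossingwiseE smoothingE.
  by have [l o r] := cornersA c; case: k; rewrite ?l ?o ?r ?negbK.
have seifert_outgoing : seifert_walk \in 'N(outgoing | 'P).
  apply/astabs_permP=> y; rewrite permM -[in RHS](aK y) a_outgoing.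
  by case: (a y) => c k; rewrite crossingwiseE smoothingE !inE; case: k.
have [] := @odd_restr_twists _ A (sideways S)
  (fun=> tperm InCorner OutCorner * tperm LeftCorner RightCorner).
  move=> c _; have [l o r] := cornersA c.
  by apply: twist_at_double; rewrite ?l ?o ?r.
move=> nS oddS; have [] := @odd_restr_twists _ outgoing [set: C]
  (fun=> tperm LeftCorner OutCorner * tperm InCorner RightCorner).
  by move=> c _; apply: twist_at_double; rewrite ?inE.
move=> nC oddC.
rewrite straight_walk_seifert odd_restr_permM // oddC cardsT.
rewrite (@odd_restr_half _ _ a _ A) //; last first.
  exact: smoothed_walk_conj_reverse.
have := odd_restr_porbit (smoothed_walk a S) x.
rewrite -/A {1}smoothed_walk_sideways odd_restr_permM // oddS.
have /double_inj -> : #|A|.*2 = #|outgoing|.*2.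
  by rewrite (card_half aA) (card_half a_outgoing).
by move <-; rewrite addbK.
Qed.

End StateParity.

(** * From diagrams to darts *)

Section Darts.
Variable D : link_diagram.
Local Notation dart := (crossing D * corner)%type.
Local Notation arc := (@Defs.arc D).

Definition dart_out (p : crossing D * bool) : dart :=
  (p.1, if p.2 then OutCorner else LeftCorner).

Definition dart_in (p : crossing D * bool) : dart :=
  (p.1, if p.2 then RightCorner else InCorner).

Definition reverse_fun (x : dart) : dart :=
  match x.2 with
  | LeftCorner => dart_in (arc (x.1, false))
  | OutCorner => dart_in (arc (x.1, true))
  | InCorner => dart_out ((arc)^-1 (x.1, false))
  | RightCorner => dart_out ((arc)^-1 (x.1, true))
  end.

Lemma reverse_fun_out p : reverse_fun (dart_out p) = dart_in (arc p).
Proof. by case: p => c []. Qed.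

Lemma reverse_fun_in p : reverse_fun (dart_in p) = dart_out ((arc)^-1 p).
Proof. by case: p => c []. Qed.

Variant dart_spec : dart -> Prop :=
  | DartOut p : dart_spec (dart_out p)
  | DartIn p : dart_spec (dart_in p).

Lemma dartP x : dart_spec x.
Proof.
case: x => c []; [exact: (DartIn (c, false)) | exact: (DartOut (c, true))
  | exact: (DartOut (c, false)) | exact: (DartIn (c, true))].
Qed.

Lemma reverse_funK : involutive reverse_fun.
Proof.
by move=> x; case: (dartP x) => p; rewrite ?reverse_fun_out ?reverse_fun_in
  ?reverse_fun_out ?reverse_fun_in ?permK ?permKV.
Qed.

Definition reverse : {perm dart} := perm (inv_inj reverse_funK).

Lemma reverseK : involutive reverse.
Proof. by move=> x; rewrite !permE reverse_funK. Qed.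

Lemma reverse_out p : reverse (dart_out p) = dart_in (arc p).
Proof. by rewrite permE reverse_fun_out. Qed.

Lemma reverse_in p : reverse (dart_in p) = dart_out (arc^-1 p).
Proof. by rewrite permE reverse_fun_in. Qed.

Lemma dart_out_outgoing p : dart_out p \in outgoing (crossing D).
Proof. by rewrite inE; case: p => c []. Qed.

Lemma dart_in_outgoing p : dart_in p \in outgoing (crossing D) = false.
Proof. by rewrite inE; case: p => c []. Qed.

Lemma reverse_outgoing x :
  (reverse x \in outgoing (crossing D)) = (x \notin outgoing (crossing D)).
Proof.
by case: (dartP x) => p; rewrite ?reverse_out ?reverse_in
  ?dart_out_outgoing ?dart_in_outgoing.
Qed.

Lemma reverse_free x : reverse x != x.
Proof.
by apply/eqP=> eqx; have := reverse_outgoing x; rewrite eqx; case: (_ \in _).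
Qed.

(** A dart is identified with the left side of its edge, walked away from the
    crossing; in a diagram without crossing-free circles, every side is obtained
    in this way. *)
Definition dart_side (x : dart) : side D := corner_side x.1 x.2.

Lemma dart_side_out p : dart_side (dart_out p) = (inl p, false).
Proof. by case: p => c []. Qed.

Lemma dart_side_in p : dart_side (dart_in p) = (inl (arc^-1 p), true).
Proof. by case: p => c []. Qed.

Lemma dart_side_inj : injective dart_side.
Proof.
move=> x y; case: (dartP x) => p; case: (dartP y) => q;
  rewrite ?dart_side_out ?dart_side_in => -[] //.
- by move->.
- by move/perm_inj->.
Qed.

Lemma dart_side_reverse x :
  dart_side (reverse x) = ((dart_side x).1, ~~ (dart_side x).2).
Proof.
by case: (dartP x) => p; rewrite ?reverse_out ?reverse_in
  !(dart_side_out, dart_side_in) ?permK.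
Qed.

Lemma boundary_dart x :
  boundary D (dart_side x) = dart_side (region_walk reverse x).
Proof.
rewrite permE permM; case: (dartP x) => p.
  rewrite reverse_out dart_side_out /= /corner_ahead.
  by rewrite /dart_in crossingwiseE permE; case: (arc p) => c [].
rewrite reverse_in dart_side_in /= /corner_ahead.
by case: (arc^-1 p) => c []; rewrite /dart_out crossingwiseE permE.
Qed.

Lemma region_of_dart x :
  region_of_side (dart_side x) = dart_side @: porbit (region_walk reverse) x.
Proof. exact: porbit_codom boundary_dart x. Qed.

Lemma eq_region_of_dart x y :
  (region_of_side (dart_side x) == region_of_side (dart_side y))
    = (x \in porbit (region_walk reverse) y).
Proof.
by rewrite !region_of_dart (inj_eq (imset_inj dart_side_inj)) eq_porbit_mem.
Qed.

Lemma straight_walk_out p :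
  straight_walk reverse (dart_out p)
    = dart_out ((arc p).1, ~~ (arc p).2).
Proof.
rewrite permM reverse_out /dart_in crossingwiseE permM !permE.
by case: (arc p) => c [].
Qed.

Lemma circle_isolated o (e : edge D) :
  connect (@touching D) (inr o) e -> e = inr o.
Proof.
case/connectP=> -[|e1 q] //= /andP[/existsP[c /andP[inc _]] _].
by case/existsP: inc => b /orP[].
Qed.

(** A set of darts stable under reversal and under the region walks is stable
    under [turn]; so with one dart it contains all darts of its crossing, then
    those of the crossings at the other ends of their edges. *)
Lemma connected_darts (B : {set dart}) (d : dart) :
    connected_diagram D -> d \in B -> reverse \in 'N(B | 'P) ->
    region_walk reverse \in 'N(B | 'P) ->
  B = setT.
Proof.
move=> /forallP conn dB /astabs_permP nB /astabs_permP phiB.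
have turnB c k : ((c, turn k) \in B) = ((c, k) \in B).
  by rewrite -[in RHS]nB -[in RHS]phiB permM reverseK crossingwiseE.
have crossB c k l : (c, k) \in B -> (c, l) \in B.
  have := (turnB c InCorner, turnB c LeftCorner, turnB c OutCorner).
  by rewrite !permE /= => -[[h1 h2] h3]; case: k; case: l; rewrite ?h3 ?h2 ?h1.
have edgeB x y : (dart_side x).1 = (dart_side y).1 -> x \in B -> y \in B.
  move=> exy xB; have [eqb|neqb] := eqVneq (dart_side x).2 (dart_side y).2.
    rewrite -(@dart_side_inj x y) // [LHS]surjective_pairing exy eqb.
    by rewrite -surjective_pairing.
  have -> : y = reverse x; last by rewrite nB.
  apply: dart_side_inj; rewrite dart_side_reverse exy [LHS]surjective_pairing.
  by case: (_.2) (_.2) neqb => [] [].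
have incidentE e c : incident e c -> exists k, e = (dart_side (c, k)).1.
  case/existsP=> -[] /orP[] /eqP->; [exists OutCorner | exists RightCorner
    | exists LeftCorner | exists InCorner] => //.
have path_B q : forall x y, path (@touching D) (dart_side x).1 q ->
    last (dart_side x).1 q = (dart_side y).1 -> x \in B -> y \in B.
  elim: q => [|e q IHq] x y /=; first by move=> _; apply: edgeB.
  case/andP=> /existsP[c /andP[/incidentE[k xk] /incidentE[l el]]].
  rewrite el => pq lq xB; apply: IHq pq lq _.
  exact: crossB (edgeB _ _ xk xB).
apply/setP=> y; rewrite inE.
have /forallP/(_ (dart_side y).1)/connectP[q pq lq] := conn (dart_side d).1.
by apply: path_B pq _ dB.
Qed.

Lemma card_crossing_state (S : crossing D -> corner) :
  #|crossing D| = (#|black_holes S| + #|white_holes S| + #|sideways S|)%N.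
Proof.
rewrite -(cardsC (sideways S)) addnC; congr (_ + _)%N.
rewrite -cardsUI; have -> : black_holes S :&: white_holes S = set0.
  by apply/setP=> c; rewrite !inE; case: (S c).
rewrite cards0 addn0; congr #|pred_of_set _|.
by apply/setP=> c; rewrite !inE; case: (S c).
Qed.

End Darts.

Local Close Scope group_scope.

Section Components.
Variable D : link_diagram.
Hypothesis no_circle : circle D -> False.

Lemma odd_straight_components :
  odd_perm (restr_perm (outgoing (crossing D)) (straight_walk (reverse D)))
    = odd #|outgoing (crossing D)| (+) odd (num_components D).
Proof.
pose f (e : edge D) := match e with
  | inl p => dart_out p
  | inr o => match no_circle o with end
  end.
have f_inj : injective f.
  move=> [[c b]|o] [[c' b']|o'] /=; try by case: no_circle.
  by rewrite /dart_out; case: b; case: b' => // -[->].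
have <- : f @: edge D = outgoing (crossing D).
  apply/setP=> x; case: (dartP x) => p.
    by rewrite dart_out_outgoing (imset_f f (isT : inl p \in edge D)).
  rewrite dart_in_outgoing; apply/negP=> /imsetP[[q|o] _ /= eqx].
    by have := dart_in_outgoing p; rewrite eqx dart_out_outgoing.
  by case: no_circle.
apply: odd_restr_codom => // -[p|o] /=; last by case: no_circle.
by rewrite straight_walk_out permE.
Qed.

End Components.

(** A crossing-free circle is a connected component of the diagram, so it is the
    whole diagram. *)
Lemma round_unknot (D : link_diagram) (o : circle D) :
  connected_diagram D -> (crossing D -> False) /\ num_components D = 1.
Proof.
move=> /forallP conn; have edgeE (e : edge D) : e = inr o.
  by have /forallP/(_ e)/circle_isolated := conn (inr o).
split=> [c|]; first by have := edgeE (edge_from c true).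
rewrite /num_components -(cards1 (porbit (straight D) (inr o))).
congr #|pred_of_set _|; apply/setP=> P; rewrite inE.
apply/imsetP/eqP => [[e _ ->]|->]; first by rewrite (edgeE e).
by exists (inr o).
Qed.

Lemma odd_holes (D : link_diagram) (r1 r2 : {set side D})
    (S : crossing D -> corner) :
    connected_diagram D -> adjacent r1 r2 -> FKT_state r1 r2 S ->
  odd (#|black_holes S| + #|white_holes S|) = ~~ odd (num_components D).
Proof.
move=> conn /andP[_ /existsP[e sides]] [unstarred inj_regions].
case: e sides => [p|o] sides; last first.
  have [no_crossing ->] := round_unknot o conn.
  by rewrite !eq_card0 // => c; case: (no_crossing c).
have no_circle (o : circle D) : False.
  move/forallP: conn => /(_ (inr o))/forallP/(_ (inl p)).
  by move/circle_isolated.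
pose d := dart_out p.
have regE1 : region_of_side (inl p, false) = region_of_side (dart_side d).
  by rewrite dart_side_out.
have regE2 : region_of_side (inl p, true)
    = region_of_side (dart_side (reverse D d)).
  by rewrite dart_side_reverse dart_side_out.
have unstarred_d c : (marked S c \notin porbit (region_walk (reverse D)) d)
    && (marked S c \notin porbit (region_walk (reverse D)) (reverse D d)).
  rewrite -!eq_region_of_dart -regE1 -regE2; have [n1 n2] := unstarred c.
  by case/orP: sides => /andP[/eqP <- /eqP <-]; apply/andP.
have marked_inj c c' :
    marked S c' \in porbit (region_walk (reverse D)) (marked S c) -> c = c'.
  by rewrite -eq_region_of_dart => /eqP/esym/inj_regions.
have [revA phiA] := state_trail (@reverseK D) (@reverse_free D) unstarred_d
  marked_inj (fun B => @connected_darts D B d conn).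
have := odd_straight_walk (@reverseK D) (@reverse_outgoing D) revA phiA.
rewrite odd_straight_components // (card_crossing_state S) oddD.
by do 4!case: (odd _).
Qed.

Theorem proposition2p3 (D : link_diagram)
    (D_planar : planar_diagram D) (D_connected : connected_diagram D)
    (r1 r2 : {set side D})
    (r1_region : r1 \in regions D) (r2_region : r2 \in regions D)
    (r1_r2_adjacent : adjacent r1 r2)
    (S : crossing D -> corner) (S_state : FKT_state r1 r2 S) :
  [/\ odd (num_components D) ->
        odd #|black_holes S| = odd #|white_holes S|,
      ~~ odd (num_components D) ->
        odd #|black_holes S| <> odd #|white_holes S|
    & #|black_holes S| + #|white_holes S| = num_components D + 1 %[mod 2]].
Proof.
have odd_sum := odd_holes D_connected r1_r2_adjacent S_state.
rewrite oddD in odd_sum; split.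
- by move=> odd_mu; move: odd_sum; rewrite odd_mu; do 2!case: (odd _).
- by move=> /negbTE odd_mu; move: odd_sum; rewrite odd_mu; do 2!case: (odd _).
by rewrite !modn2 !oddD odd_sum addbT.
Qed.
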